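(* In the class of all graphs, the property of having size exactly continuum is expressible in the modal language of graph theory: there is a sentence $\psi_{\mathfrak{c}}\in\mathcal{L}_\sim^{\Diamond}$ such that for every graph $G$, $$G\models\psi_{\mathfrak{c}}\quad\text{if and only if}\quad |G|=\mathfrak{c}.$$
   Context: $|G|$ is the cardinality of the vertex set of $G$ and $\mathfrak{c}=2^{\aleph_0}$. A graph is a set of vertices (of any cardinality) together with an irreflexive symmetric binary edge relation $\sim$. $\mathcal{L}_\sim$ is the first-order language (with equality) whose only non-logical symbol is the binary relation symbol $\sim$. $\mathcal{L}_\sim^{\Diamond}$ is the full first-order modal language, closing $\mathcal{L}_\sim$ under the modal operators $\Diamond,\Box$, Boolean connectives and quantifiers. Formulas are evaluated at graphs, within the class of all graphs under the substructure relation: $G\models\Diamond\varphi[\bar a]$ iff there is a graph $H$ containing $G$ as a substructure (i.e. $G$ is an induced subgraph of $H$) with $H\models\varphi[\bar a]$; $G\models\Box\varphi[\bar a]$ iff $H\models\varphi[\bar a]$ for every graph $H$ containing $G$ as a substructure; Boolean connectives and quantifiers are interpreted as usual, with quantifiers ranging over the vertices of the graph at which the formula is evaluated. *)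

(* Defs.v *)
From mathcomp Require Import all_boot.
From mathcomp Require Import boolp classical_sets functions cardinality.

Set Implicit Arguments.
Unset Strict Implicit.
Unset Printing Implicit Defensive.

(* The vertex type may be empty and has no size restriction. *)
Record graph := Graph {
  vertex :> Type;
  adj : vertex -> vertex -> Prop;
  adj_irr : forall x, ~ adj x x;
  adj_sym : forall x y, adj x y -> adj y x }.

(* [f] identifies [G] with an induced subgraph of [H]; the extensions of [G]
   as a substructure are, up to isomorphism over [G], exactly such pairs
   [(H, f)]. *)
Definition embedding (G H : graph) (f : G -> H) : Prop :=
  injective f /\ forall x y : G, adj x y <-> adj (f x) (f y).

(* [form n] is the set of modal formulas with free variables among [n] de
   Bruijn indices; under a quantifier, [ord0] is the newly bound variable and
   [lift ord0 i] is the former variable [i]. *)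
Inductive form : nat -> Type :=
| Eq n of 'I_n & 'I_n : form n
| Adj n of 'I_n & 'I_n : form n
| Bot n : form n
| Not n of form n : form n
| And n of form n & form n : form n
| Or n of form n & form n : form n
| Imp n of form n & form n : form n
| All n of form n.+1 : form n
| Ex n of form n.+1 : form n
| Dia n of form n : form n
| Box n of form n : form n.

Arguments Bot {n}.

Definition sentence := form 0.

Definition push (V : Type) (n : nat) (v : V) (a : 'I_n -> V) : 'I_n.+1 -> V :=
  fun i => if unlift ord0 i is Some j then a j else v.

(* A sentence must also be evaluated in the empty graph, hence the empty
   assignment rather than an arbitrary one on infinitely many variables. *)
Definition empty_assignment (V : Type) (i : 'I_0) : V :=
  False_rect V (fintype0 i (card_ord 0)).

Fixpoint sat (n : nat) (phi : form n) : forall G : graph, ('I_n -> G) -> Prop :=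
  match phi in form n return forall G : graph, ('I_n -> G) -> Prop with
  | Eq _ i j => fun G a => a i = a j
  | Adj _ i j => fun G a => adj (a i) (a j)
  | Bot _ => fun G a => False
  | Not _ p => fun G a => ~ sat p a
  | And _ p q => fun G a => sat p a /\ sat q a
  | Or _ p q => fun G a => sat p a \/ sat q a
  | Imp _ p q => fun G a => sat p a -> sat q a
  | All _ p => fun G a => forall v : G, sat p (push v a)
  | Ex _ p => fun G a => exists v : G, sat p (push v a)
  | Dia _ p => fun G a =>
      exists (H : graph) (f : G -> H), embedding f /\ sat p (f \o a)
  | Box _ p => fun G a =>
      forall (H : graph) (f : G -> H), embedding f -> sat p (f \o a)
  end.

Definition models (G : graph) (psi : sentence) : Prop :=
  sat psi (@empty_assignment G).

(* Main.v *)
(* Adding vertices to a graph amounts to quantifying over sets of vertices. So one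
   can say in an extension K of G that the neighbours of a vertex n form a path
   starting at o, and that the neighbours of h and k are disjoint sets of
   vertices, each vertex being determined by its trace on the path, that is, by
   at most a real. When the path is infinite and all traces occur, such a
   configuration (a "frame") is rigid: no extension that is still a frame
   enlarges these sets. Hence "some extension codes a surjection of the
   neighbours of h onto those of k" means what it says.
   To make h mark G, one first extends G to a graph in which h is adjacent to
   every other vertex; later extensions can only add neighbours of h. If G embeds
   in a frame in this way then |G| is at most the continuum c. If moreover no
   extension codes a surjection of the neighbours of h onto those of k then
   |G| < c, and conversely |G| < c allows a rigid frame in which c many reals are
   left to the neighbours of k. The sentence says that G has a frame, but none
   without such a surjection. *)

Require Import Defs.
From mathcomp Require Import all_boot.
From mathcomp Require Import boolp classical_sets functions cardinality.
From mathcomp Require Import zify.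

Set Implicit Arguments.
Unset Strict Implicit.
Unset Printing Implicit Defensive.

Local Open Scope classical_set_scope.
Local Open Scope card_scope.

(** * De Bruijn assignments and unfolding of satisfaction *)

Lemma push0 (V : Type) n (v : V) (a : 'I_n -> V) : push v a ord0 = v.
Proof. by rewrite /push unlift_none. Qed.

Lemma pushS (V : Type) n (v : V) (a : 'I_n -> V) i :
  push v a (lift ord0 i) = a i.
Proof. by rewrite /push liftK. Qed.

Definition pushE := (push0, pushS).

Lemma and_congr (A B C D : Prop) : (A <-> B) -> (C <-> D) -> (A /\ C <-> B /\ D).
Proof. tauto. Qed.

Lemma or_congr (A B C D : Prop) : (A <-> B) -> (C <-> D) -> (A \/ C <-> B \/ D).
Proof. tauto. Qed.

Lemma imp_congr (A B C D : Prop) :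
  (A <-> B) -> (C <-> D) -> ((A -> C) <-> (B -> D)).
Proof. tauto. Qed.

Lemma all_congr T (P Q : T -> Prop) :
  (forall x, P x <-> Q x) -> ((forall x, P x) <-> (forall x, Q x)).
Proof. by move=> PQ; split=> h x; apply/PQ. Qed.

Lemma ex_congr T (P Q : T -> Prop) :
  (forall x, P x <-> Q x) -> ((exists x, P x) <-> (exists x, Q x)).
Proof. by move=> PQ; split=> -[x /PQ h]; exists x. Qed.

Ltac sat_congr := repeat first
  [ apply: all_congr => ? | apply: ex_congr => ? | apply: and_congr
  | apply: or_congr | apply: imp_congr | by rewrite /= ?pushE /= ?pushE ].

Local Notation "↑ i" := (lift ord0 i) (at level 8, right associativity).
Local Notation "x ~ y" := (Adj x y) (at level 20, no associativity).
Local Notation "x ≐ y" := (Eq x y) (at level 20, no associativity).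
Local Notation "p ⩓ q" := (And p q) (at level 30, right associativity).
Local Notation "p ⩔ q" := (Or p q) (at level 31, right associativity).
Local Notation "p ⇒ q" := (Imp p q) (at level 32, right associativity).
Local Notation "∀' p" := (All p) (at level 33, right associativity).
Local Notation "∃' p" := (Ex p) (at level 33, right associativity).
Local Notation "□ p" := (Box p) (at level 33, right associativity).
Local Notation "◇ p" := (Dia p) (at level 33, right associativity).

(** * Graph properties, each with its modal formula *)

Definition dominating (G : graph) (h : G) : Prop := forall x, x = h \/ adj x h.

Definition dominating_form n (h : 'I_n) : form n :=
  ∀' (ord0 ≐ ↑h ⩔ ord0 ~ ↑h).

(* The neighbours of [s] in an extension play the role of a monadic second-order
   variable, so [reachable] is connectedness of [o] and [x] in the subgraph
   induced on the neighbours of [n]. *)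
Definition reachable (G : graph) (n o x : G) : Prop :=
  forall (H : graph) (f : G -> H), embedding f -> forall s : H,
  adj (f o) s ->
  (forall y z, adj y (f n) -> adj z (f n) -> adj y z -> adj y s -> adj z s) ->
  adj (f x) s.

Definition reachable_form m (n o x : 'I_m) : form m :=
  □ ∀' (↑o ~ ord0 ⇒
    (∀' ∀' (↑ord0 ~ ↑↑↑n ⇒ ord0 ~ ↑↑↑n ⇒
       ↑ord0 ~ ord0 ⇒ ↑ord0 ~ ↑↑ord0 ⇒ ord0 ~ ↑↑ord0)) ⇒
    ↑x ~ ord0).

(* The degree bounds make an infinite ray starting at [o] maximal, hence
   unchanged in extensions. *)
Definition path_on (G : graph) (n o : G) : Prop :=
  adj o n /\
  (forall x y, adj x n -> adj y n -> adj x o -> adj y o -> x = y) /\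
  (forall v x y z, adj v n -> adj x n -> adj y n -> adj z n ->
     adj x v -> adj y v -> adj z v -> x = y \/ x = z \/ y = z) /\
  (forall x, adj x n -> reachable n o x).

Definition path_on_form m (n o : 'I_m) : form m :=
  o ~ n ⩓
  (∀' ∀' (↑ord0 ~ ↑↑n ⇒ ord0 ~ ↑↑n ⇒ ↑ord0 ~ ↑↑o ⇒ ord0 ~ ↑↑o ⇒
     ↑ord0 ≐ ord0)) ⩓
  (∀' ∀' ∀' ∀' (↑↑↑ord0 ~ ↑↑↑↑n ⇒ ↑↑ord0 ~ ↑↑↑↑n ⇒
     ↑ord0 ~ ↑↑↑↑n ⇒ ord0 ~ ↑↑↑↑n ⇒
     ↑↑ord0 ~ ↑↑↑ord0 ⇒ ↑ord0 ~ ↑↑↑ord0 ⇒ ord0 ~ ↑↑↑ord0 ⇒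
     ↑↑ord0 ≐ ↑ord0 ⩔ ↑↑ord0 ≐ ord0 ⩔ ↑ord0 ≐ ord0)) ⩓
  (∀' (ord0 ~ ↑n ⇒ reachable_form (↑n) (↑o) ord0)).

(* The neighbours of [d] and of [k] are disjoint sets of subsets of the set of
   neighbours of [n], a vertex standing for its trace on the latter. *)
Definition frame (G : graph) (n o d k : G) : Prop :=
  path_on n o /\
  (~ adj n d /\ ~ adj n k /\ ~ adj d k) /\
  (forall x, adj x d -> ~ adj x k) /\
  (forall x y, adj x d \/ adj x k -> adj y d \/ adj y k ->
     (forall z, adj z n -> ((adj x z -> adj y z) /\ (adj y z -> adj x z))) ->
     x = y).

Definition frame_form m (n o d k : 'I_m) : form m :=
  path_on_form n o ⩓
  (Not (n ~ d) ⩓ Not (n ~ k) ⩓ Not (d ~ k)) ⩓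
  (∀' (ord0 ~ ↑d ⇒ Not (ord0 ~ ↑k))) ⩓
  (∀' ∀' (↑ord0 ~ ↑↑d ⩔ ↑ord0 ~ ↑↑k ⇒ ord0 ~ ↑↑d ⩔ ord0 ~ ↑↑k ⇒
     (∀' (ord0 ~ ↑↑↑n ⇒
        (↑↑ord0 ~ ord0 ⇒ ↑ord0 ~ ord0) ⩓ (↑ord0 ~ ord0 ⇒ ↑↑ord0 ~ ord0))) ⇒
     ↑ord0 ≐ ord0)).

(* The neighbours of [m] encode a partial surjection from the neighbours of [d]
   onto those of [k]. *)
Definition onto (G : graph) (d k m : G) : Prop :=
  (forall x, adj x k -> exists y w, adj y d /\ adj w m /\ adj w y /\ adj w x) /\
  (forall y x x' w w', adj y d -> adj x k -> adj x' k -> adj w m -> adj w' m ->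
     adj w y -> adj w x -> adj w' y -> adj w' x' -> x = x').

Definition onto_form n (d k m : 'I_n) : form n :=
  (∀' (ord0 ~ ↑k ⇒ ∃' ∃' (↑ord0 ~ ↑↑↑d ⩓
     ord0 ~ ↑↑↑m ⩓ ord0 ~ ↑ord0 ⩓ ord0 ~ ↑↑ord0))) ⩓
  (∀' ∀' ∀' ∀' ∀' (↑↑↑↑ord0 ~ ↑↑↑↑↑d ⇒ ↑↑↑ord0 ~ ↑↑↑↑↑k ⇒
     ↑↑ord0 ~ ↑↑↑↑↑k ⇒ ↑ord0 ~ ↑↑↑↑↑m ⇒ ord0 ~ ↑↑↑↑↑m ⇒
     ↑ord0 ~ ↑↑↑↑ord0 ⇒ ↑ord0 ~ ↑↑↑ord0 ⇒
     ord0 ~ ↑↑↑↑ord0 ⇒ ord0 ~ ↑↑ord0 ⇒ ↑↑↑ord0 ≐ ↑↑ord0)).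

Definition surjects (G : graph) (n o d k : G) : Prop :=
  exists (H : graph) (f : G -> H), embedding f /\
    exists m, frame (f n) (f o) (f d) (f k) /\ onto (f d) (f k) m.

Definition surjects_form m (n o d k : 'I_m) : form m :=
  ◇ ∃' (frame_form (↑n) (↑o) (↑d) (↑k) ⩓ onto_form (↑d) (↑k) ord0).

Lemma sat_surjects m (n o d k : 'I_m) (G : graph) (a : 'I_m -> G) :
  sat (surjects_form n o d k) a <-> surjects (a n) (a o) (a d) (a k).
Proof. by sat_congr. Qed.

(* [G] itself cannot be named in an extension. Instead [h] dominates some
   extension of [G], so that in any further extension the neighbourhood of [h]
   contains all of [G] but at most one vertex. *)
Definition framed (G : graph) (P : forall H : graph, H -> H -> H -> H -> Prop) :=
  exists (H : graph) (f : G -> H), embedding f /\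
  exists h, dominating h /\
  exists (K : graph) (g : H -> K), embedding g /\
  exists n o k, frame n o (g h) k /\ P K n o (g h) k.

Definition framed_form (p : form 4) : sentence :=
  ◇ ∃' (dominating_form ord0 ⩓ ◇ ∃' ∃' ∃' (
    frame_form (↑↑ord0) (↑ord0) (↑↑↑ord0) ord0 ⩓ p)).

Lemma models_framed (p : form 4) P :
  (forall (G : graph) (a : 'I_4 -> G),
     sat p a <-> P G (a (↑↑ord0)) (a (↑ord0)) (a (↑↑↑ord0)) (a ord0)) ->
  forall G, models G (framed_form p) <-> framed G P.
Proof.
move=> pP G; rewrite /models /framed /=; sat_congr.
by rewrite pP !pushE /= !pushE.
Qed.

(** * Path induction and the bound on frames *)

Lemma embedding_comp (G H K : graph) (f : G -> H) (g : H -> K) :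
  embedding f -> embedding g -> embedding (g \o f).
Proof.
move=> [fI fA] [gI gA]; split; first exact: inj_comp.
by move=> x y; rewrite fA gA.
Qed.

Definition sym_graph (V : Type) (e : V -> V -> Prop) (e_irr : forall x, ~ e x x) :
  graph.
Proof.
exists V (fun x y => e x y \/ e y x); first by move=> x [] /e_irr.
by move=> x y []; [right|left].
Defined.

Section AddVertex.
Variables (G : graph) (X : G -> Prop).

Definition add_edge (x y : option G) : Prop :=
  match x, y with
  | Some x, Some y => adj x y
  | Some x, None => X x
  | None, _ => False
  end.

Lemma add_edge_irr x : ~ add_edge x x.
Proof. by case: x => //= x; apply: adj_irr. Qed.

Definition add_vertex : graph := sym_graph add_edge_irr.

Lemma embedding_add_vertex : embedding (Some : G -> add_vertex).
Proof.
split=> [x y [] //|x y /=]; split; first by left.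
by case=> // /adj_sym.
Qed.

End AddVertex.

Lemma reachable_ind (G : graph) (n o x : G) (X : G -> Prop) :
  adj o n -> reachable n o x -> X o ->
  (forall y z, adj y n -> adj z n -> adj y z -> X y -> X z) -> X x.
Proof.
move=> on r Xo Xs.
(* Intersecting with the neighbours of [n] keeps the new vertex from being adjacent to [n], so it
   does not lengthen the path. *)
pose Y z := X z /\ adj z n.
have [] // := r (add_vertex Y) _ (embedding_add_vertex Y) None.
- by left.
- move=> [y|] [z|]; try by [move=> [[]|[_ /adj_irr]]|move=> _ [[]|[_ /adj_irr]]].
  move=> yn zn yz [] // [Xy _]; left.
  have sym u v : adj u v \/ adj v u -> adj u v by case=> // /adj_sym.
  by split; [apply: (Xs y) => //; apply: sym|apply: sym].
- by case.
Qed.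

(* Binary words describe walks from [o]: at each vertex [e] lists its at most
   two neighbours. *)
Lemma path_enum (G : graph) (n o : G) :
  path_on n o -> exists p : seq bool -> G, forall x, adj x n -> exists w, x = p w.
Proof.
move=> [on [_ [deg conn]]].
pose nb v x := adj x n /\ adj x v.
have /choice [e eP] : forall v, exists e : bool -> G, adj v n ->
    forall x, nb v x -> exists b, x = e b.
  move=> v; have [[x [xn xv]]|nx] := pselect (exists x, nb v x); last first.
    by exists (fun=> v) => _ x vx; case: nx; exists x.
  have [[y [[yn yv] yx]]|ny] := pselect (exists y, nb v y /\ y <> x).
    exists (fun b => if b then x else y) => vn z [zn zv].
    have [?|[->|->]] := deg v _ _ _ vn xn yn zn xv yv zv.
    - by case: yx.
    - by exists true.
    - by exists false.
  exists (fun=> x) => _ z vz; exists true.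
  by apply: contrapT => zx; apply: ny; exists z.
exists (foldr (fun b v => e v b) o) => x xn.
apply: (reachable_ind (X := fun x => exists w, x = _ w) on (conn x xn)).
  by exists [::].
move=> y z yn zn yz [w yw].
have [|b ->] := eP y yn z; first by split=> //; exact: adj_sym.
by exists (b :: w) => /=; rewrite -yw.
Qed.

(** The path is enumerated by binary words, so a trace on it is a real; numbers coding no word get
    the value [false]. *)
Lemma frame_inj (G : graph) (n o d k : G) : frame n o d k ->
  exists t : G -> nat -> bool, forall x y, adj x d \/ adj x k ->
    adj y d \/ adj y k -> t x = t y -> x = y.
Proof.
move=> [/path_enum [p pP] [_ [_ sep]]].
exists (fun x i => if unpickle i is Some w then `[< adj x (p w) >] else false).
move=> x y xR yR txy; apply: sep => // z /pP [w ->].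
have xy : `[< adj x (p w) >] = `[< adj y (p w) >].
  by move: (congr1 (fun u => u (pickle w)) txy); rewrite pickleK.
by split=> /asboolP; [rewrite xy|rewrite -xy] => /asboolP.
Qed.

(** * Coding the inverse of an injection in an extension *)

Section Gadgets.
Variables (G : graph) (K : G -> Prop) (j : G -> G).

(* The gadget [inr (Some x)] joins [x] to [j x], and [inr None] marks the
   gadgets. *)
Definition gadget_edge (x y : G + option G) : Prop :=
  match x, y with
  | inl x, inl y => adj x y
  | inr (Some x), inl y => K x /\ (y = x \/ y = j x)
  | inr (Some _), inr None => True
  | _, _ => False
  end.

Lemma gadget_edge_irr x : ~ gadget_edge x x.
Proof. by case: x => [x|[x|]] //=; apply: adj_irr. Qed.

Definition gadget_graph : graph := sym_graph gadget_edge_irr.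

Lemma embedding_gadget : embedding (inl : G -> gadget_graph).
Proof.
split=> [x y [] //|x y /=]; split; first by left.
by case=> // /adj_sym.
Qed.

Lemma adj_gadget_inl (x y : G) :
  @adj gadget_graph (inl x) (inl y) <-> adj x y.
Proof. by have [_ ->] := embedding_gadget. Qed.

Lemma adj_gadget_inr (x : gadget_graph) (y : G) :
  (forall x, K x -> x <> y /\ j x <> y) ->
  adj x (inl y : gadget_graph) -> exists2 z, x = inl z & adj z y.
Proof.
move=> Ky; case: x => [x /adj_gadget_inl|[x|]] /=; first by exists x.
  by case=> // -[/Ky[xy jxy] []] => [/esym|/esym].
by case.
Qed.

End Gadgets.

(** Gadgets are attached only to neighbours of [k] and [d]. None of [n], [d], [k] is such a vertex,
    so their neighbourhoods do not grow and the frame survives. *)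
Lemma frame_surjects (G : graph) (n o d k : G) (j : G -> G) :
  frame n o d k -> (forall x, adj x k -> adj (j x) d) ->
  (forall x y, adj x k -> adj y k -> j x = j y -> x = y) -> surjects n o d k.
Proof.
move=> fr jd jI; set K := fun x => adj x k.
have [[on [deg1 [deg2 conn]]] [[nd [nk dk]] [disj sep]]] := fr.
have emb := @embedding_gadget G K j.
exists (gadget_graph K j), inl; split=> //; exists (inr None).
have inlA x y : @adj (gadget_graph K j) (inl x) (inl y) <-> adj x y.
  exact: adj_gadget_inl.
have sym (x y : G) : adj x y -> adj y x by apply: adj_sym.
have atn x : @adj (gadget_graph K j) x (inl n) -> exists2 z, x = inl z & adj z n.
  by apply: adj_gadget_inr => x' Kx; split=> E; [apply: nk|apply: nd];
     rewrite -E //; apply: jd.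
have atd x : @adj (gadget_graph K j) x (inl d) -> exists2 z, x = inl z & adj z d.
  apply: adj_gadget_inr => x' Kx; split=> E; first by apply: dk; rewrite -E.
  by apply: (@adj_irr G d); rewrite -{1}E; apply: jd.
have atk x : @adj (gadget_graph K j) x (inl k) -> exists2 z, x = inl z & adj z k.
  apply: adj_gadget_inr => x' Kx; split=> E.
    by apply: (@adj_irr G k); rewrite -{1}E.
  by apply: dk; apply: sym; rewrite -E; apply: jd.
have atR x : @adj (gadget_graph K j) x (inl d) \/ @adj (gadget_graph K j) x (inl k) ->
    exists2 z, x = inl z & adj z d \/ adj z k.
  by case=> [/atd|/atk] [z -> ?]; exists z; tauto.
split.
- split; [split; [|split; [|split]]|split; [|split]].
  + exact/inlA.
  + move=> x y /atn[{}x -> xn] /atn[{}y -> yn] /inlA xo /inlA yo.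
    by congr inl; apply: deg1.
  + move=> v x y z /atn[{}v -> vn] /atn[{}x -> xn] /atn[{}y -> yn] /atn[{}z -> zn].
    move=> /inlA xv /inlA yv /inlA zv.
    by have [->|[->|->]] := deg2 v x y z vn xn yn zn xv yv zv; tauto.
  + move=> x /atn[{}x -> xn] H f femb; apply: (conn x xn H (f \o inl)).
    exact: embedding_comp emb femb.
  + by rewrite !inlA.
  + by move=> x /atd[{}x -> xd] /inlA; apply: disj.
  + move=> x y /atR[{}x -> xR] /atR[{}y -> yR] xy; congr inl; apply: sep => // z zn.
    by have := xy (inl z); rewrite !inlA; apply.
- split.
    move=> x /atk[{}x -> xk]; exists (inl (j x)), (inr (Some x)).
    split; first by apply/inlA; apply: jd.
    by split; [left|split; left; split=> //; [right|left]].
  have gad (w y : gadget_graph K j) z : adj w (inr None : gadget_graph K j) ->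
      y = inl z -> adj w y -> exists2 x, w = inr (Some x) & K x /\ (z = x \/ z = j x).
    case: w => [w|[x|]] /=; try by [case].
    by move=> _ -> [] // [Kx zx]; exists x.
  move=> y x x' w w' /atd[{}y -> yd] /atk[{}x -> xk] /atk[{}x' -> xk'].
  move=> wm wm' wy wx wy' wx'; congr inl.
  (* By disjointness, the end of a gadget that lies next to [d] can only be its [j u], and the end
     next to [k] its [u]. *)
  have Kd z : adj z d -> K z -> False by move=> /disj.
  have [u wu [Ku yu]] := gad _ _ _ wm erefl wy.
  have [u' wu' [Ku' yu']] := gad _ _ _ wm' erefl wy'.
  have {}yu : y = j u by case: yu => // E; case: (Kd y) => //; rewrite E.
  have {}yu' : y = j u' by case: yu' => // E; case: (Kd y) => //; rewrite E.
  have uu' : u = u' by apply: jI => //; rewrite -yu.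
  have [v] := gad _ _ _ wm erefl wx; rewrite wu => -[<-] [_ xu].
  have [v'] := gad _ _ _ wm' erefl wx'; rewrite wu' => -[<-] [_ xu'].
  case: xu => [->|E]; last by case: (Kd x) => //; rewrite E; apply: jd.
  by case: xu' => [->|E] //; case: (Kd x') => //; rewrite E; apply: jd.
Qed.

(** * A rigid frame built from an injection into the reals *)

Section Coding.
Variables (G : graph) (e : G -> nat -> bool).
Hypothesis e_inj : injective e.

Inductive code_vertex : Type :=
| Old of G | Num of nat | Real of nat -> bool | Nums | Range | Rest.

(* [Real X] is meant only for [X] outside the range of [e], the other reals
   being represented by the vertices of [G]. *)
Definition code_edge (x y : code_vertex) : Prop :=
  match x, y with
  | Old x, Old y => adj x y
  | Old x, Num i => e x i
  | Real X, Num i => X i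
  | Num i, Num j => j = i.+1
  | Num _, Nums => True
  | Old _, Range => True
  | Real X, Rest => forall x, e x <> X
  | _, _ => False
  end.

Lemma code_edge_irr x : ~ code_edge x x.
Proof. by case: x => //= [x|i]; [apply: adj_irr|lia]. Qed.

Definition code_graph : graph := sym_graph code_edge_irr.

Local Notation cadj := (@adj code_graph).

Lemma adj_Nums x : cadj x Nums -> exists i, x = Num i.
Proof. by case: x => [?|i|?|||] []//; exists i. Qed.

Lemma adj_Range x : cadj x Range -> exists v, x = Old v.
Proof. by case: x => [v|?|?|||] []//; exists v. Qed.

Lemma adj_Rest x : cadj x Rest -> exists2 X, x = Real X & forall v, e v <> X.
Proof. by case: x => [?|?|X|||] []//; exists X. Qed.

Lemma adj_Num i j : cadj (Num i) (Num j) -> j = i.+1 \/ i = j.+1.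
Proof. by []. Qed.

Lemma adj_Old_Num v i : cadj (Old v) (Num i) <-> e v i.
Proof. by split=> [[]//|]; left. Qed.

Lemma adj_Real_Num X i : cadj (Real X) (Num i) <-> X i.
Proof. by split=> [[]//|]; left. Qed.

Lemma code_path : @path_on code_graph Nums (Num 0).
Proof.
split; first by left.
split.
  move=> _ _ /adj_Nums[i ->] /adj_Nums[j ->] /adj_Num i0 /adj_Num j0.
  by congr Num; lia.
split.
  move=> _ _ _ _ /adj_Nums[a ->] /adj_Nums[b ->] /adj_Nums[c ->] /adj_Nums[d ->].
  move=> /adj_Num ab /adj_Num ac /adj_Num ad.
  have [|[|]] : b = c \/ b = d \/ c = d by lia.
  - by left; congr Num.
  - by right; left; congr Num.
  - by right; right; congr Num.
move=> _ /adj_Nums[i ->] H f [_ fA] s s0 sS; elim: i => // i.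
by apply: sS; apply/fA; left.
Qed.

Lemma code_frame : @frame code_graph Nums (Num 0) Range Rest.
Proof.
split; first exact: code_path.
split; first by split; [case|split; case].
split; first by move=> _ /adj_Range[v ->] /adj_Rest[].
have tr x : cadj x Range \/ cadj x Rest ->
    exists X : nat -> bool, (forall i, cadj x (Num i) <-> X i) /\
      ((exists2 v, x = Old v & X = e v) \/ (x = Real X /\ forall v, e v <> X)).
  case=> [/adj_Range[v ->]|/adj_Rest[X -> eX]].
    by exists (e v); split; [exact: adj_Old_Num|left; exists v].
  by exists X; split; [exact: adj_Real_Num|right].
move=> x y /tr[X [xX Xe]] /tr[Y [yY Ye]] xy.
have XY : X = Y.
  apply/funext => i; have [xy1 xy2] := xy (Num i) (or_introl I).
  by apply/idP/idP => [/xX/xy1/yY|/yY/xy2/xX].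
move: Ye; rewrite -XY; case: Xe => [[v -> Xv]|[-> Xe]] [[w -> Xw]|[-> Ye]] //.
- by congr Old; apply: e_inj; rewrite -Xv -Xw.
- by case: (Ye v).
- by case: (Xe w).
Qed.

(* The ray is unchanged in [H], so all traces are already taken in [code_graph]. *)
Lemma code_rigid (H : graph) (f : code_graph -> H) :
  embedding f -> frame (f Nums) (f (Num 0)) (f Range) (f Rest) ->
  forall x, adj x (f Range) -> exists v, x = f (Old v).
Proof.
move=> [fI fA] [[on [deg1 [deg2 conn]]] [_ [disj sep]]].
have fNums i : adj (f (Num i)) (f Nums) by apply/fA; left.
have num x : adj x (f Nums) -> exists i, x = f (Num i).
  move=> /conn /(reachable_ind (X := fun x => exists i, x = f (Num i)) on); apply.
    by exists 0%N.
  (* The known neighbours on the ray, one at [Num 0] and two elsewhere, already exhaust the degree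
     bounds. *)
  move=> _ z _ zn /[swap] -[[|i] ->] /(@adj_sym H) zi.
    exists 1%N; apply: (deg1 _ _ zn (fNums 1%N) zi).
    by apply/fA; right.
  have ii1 : adj (f (Num i)) (f (Num i.+1)) by apply/fA; left.
  have i2i1 : adj (f (Num i.+2)) (f (Num i.+1)) by apply/fA; right.
  have [/fI []|[<-|<-]] :=
    deg2 _ _ _ z (fNums i.+1) (fNums i) (fNums i.+2) zn ii1 i2i1 zi.
  - by lia.
  - by exists i.
  - by exists i.+2.
move=> x xR; pose X i := `[< adj x (f (Num i)) >].
have Xx i : adj x (f (Num i)) <-> X i by split=> /asboolP.
have [[v eX]|nX] := pselect (exists v, e v = X).
  exists v; apply: sep; [by left|by left; apply/fA; left|].
  by move=> _ /num[i ->]; rewrite -!fA Xx adj_Old_Num eX; split.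
have RX : adj (f (Real X)) (f Rest).
  by apply/fA; left => v eX; apply: nX; exists v.
(* Otherwise [x] has the trace of a neighbour of [Rest], which separation and disjointness
   exclude. *)
suff xE : x = f (Real X) by case: (disj x) => //; rewrite xE.
apply: sep; [by left|by right|].
by move=> _ /num[i ->]; rewrite -!fA Xx adj_Real_Num; split.
Qed.

(** [R] puts continuum many reals next to [Rest]. By rigidity their preimages under the coded
    surjection lie in [G], and choosing one for each is injective. *)
Lemma code_surjects (R : (nat -> bool) -> nat -> bool) : injective R ->
  (forall X v, e v <> R X) -> @surjects code_graph Nums (Num 0) Range Rest ->
  exists j : (nat -> bool) -> G, injective j.
Proof.
move=> R_inj eR [H [f [femb [m [fr [onto1 onto2]]]]]].
have fK X : adj (f (Real (R X))) (f Rest) by have [_ <-] := femb; left.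
have /choice[j jP] : forall X, exists v, exists w, adj w m /\
    adj w (f (Old v)) /\ adj w (f (Real (R X))).
  move=> X; have [y [w [yR [wm [wy wX]]]]] := onto1 _ (fK X).
  by have [v yv] := code_rigid femb fr yR; exists v, w; rewrite -yv.
exists j => X Y jXY.
have [w [wm [wj wX]]] := jP X; have [w' [wm' [wj' wY]]] := jP Y.
rewrite -jXY in wj'.
have jR : adj (f (Old (j X))) (f Range) by have [_ <-] := femb; left.
have := onto2 _ _ _ _ _ jR (fK X) (fK Y) wm wm' wj wX wj' wY.
by have [fI _] := femb; move=> /fI [/R_inj].
Qed.

End Coding.

(** * Comparison with the continuum *)

Definition scons (b : bool) (X : nat -> bool) (i : nat) : bool :=
  if i is i'.+1 then X i' else b.

Lemma scons_inj b : injective (scons b).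
Proof. by move=> X Y XY; apply/funext => i; apply: (congr1 (@^~ i.+1) XY). Qed.

(** Since [x] has at most one preimage, one of the two halves of the reals, split by the first bit,
    avoids it. *)
Lemma inj_avoid T (j : (nat -> bool) -> T) (x : T) : injective j ->
  exists2 j' : (nat -> bool) -> T, injective j' & forall X, j' X <> x.
Proof.
move=> j_inj.
have [b jb] : exists b, forall X, j (scons b X) <> x.
  have [[X jX]|nX] := pselect (exists X, j (scons true X) = x); last first.
    by exists true => X jX; apply: nX; exists X.
  by exists false => Y; rewrite -jX => /j_inj /(congr1 (@^~ 0%N)).
by exists (j \o scons b) => //; apply: inj_comp j_inj _; apply: scons_inj.
Qed.

(** [Range] serves as the dominating vertex added to [G]. *)
Lemma framed_code (G : graph) (e : G -> nat -> bool)
    (P : forall H : graph, H -> H -> H -> H -> Prop) : injective e ->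
  P (code_graph e) (Nums _) (Num _ 0) (Range _) (Rest _) -> framed G P.
Proof.
move=> e_inj PG; exists (add_vertex (fun _ : G => True)), Some.
split; first exact: embedding_add_vertex.
exists None; split; first by move=> [x|]; [right; left|left].
pose g x : code_graph e := if x is Some v then Old v else Range G.
exists (code_graph e), g; split.
  split; first by move=> [x|] [y|] // [->].
  by move=> [x|] [y|].
exists (Nums G), (Num G 0), (Rest G); split=> //.
exact: code_frame.
Qed.

Lemma framed_inj (G : graph) P : framed G P ->
  exists t : G -> nat -> bool, injective t.
Proof.
move=> [H [f [[fI _] [h [dom [K [g [[gI gA] [n [o [k [fr _]]]]]]]]]]]].
have [t t_inj] := frame_inj fr.
have Gh x : f x <> h -> adj (g (f x)) (g h).
  by have [->|? _] := dom (f x); last exact/gA.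
(* The vertex sent to [h], if any, is not its own neighbour; it gets the zero sequence, kept apart
   by the leading [true]. *)
exists (fun x => if pselect (f x = h) then xpred0 else scons true (t (g (f x)))).
move=> x y; case: pselect => xh; case: pselect => yh.
- by move=> _; apply: fI; rewrite xh yh.
- by move=> E; have := congr1 (@^~ 0%N) E.
- by move=> E; have := congr1 (@^~ 0%N) E.
- by move=> /scons_inj /t_inj xy; apply/fI/gI/xy; left; apply: Gh.
Qed.

(** Traces inject the neighbours of [k] into the reals, and [j'] injects these into the vertices of
    [G] other than [h], all neighbours of [g h]. *)
Lemma framed_surjects (G : graph) (j : (nat -> bool) -> G) : injective j ->
  ~ framed G (fun H n o d k => ~ @surjects H n o d k).
Proof.
move=> j_inj.
move=> [H [f [[fI _] [h [dom [K [g [[gI gA] [n [o [k [fr]]]]]]]]]]]].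
have [t t_inj] := frame_inj fr.
have [j' j'_inj j'h] := inj_avoid h (inj_comp fI j_inj).
apply; apply: (frame_surjects (j := g \o j' \o t) fr) => [x _|x y xk yk].
  by apply/gA; have [/j'h|] := dom (j' (t x)).
by move=> /gI/j'_inj; apply: t_inj; right.
Qed.

(** From right to left this is Cantor-Bernstein. *)
Lemma card_eq_continuum (T : Type) : [set: T] #= [set: nat -> bool] <->
  (exists t : T -> nat -> bool, injective t) /\
  (exists j : (nat -> bool) -> T, injective j).
Proof.
split=> [/pcard_eqP[f]|[[t t_inj] [j j_inj]]].
  have fI : injective f by move=> x y; apply: inj; rewrite inE.
  split; first by exists f.
  have /choice[j fj] : forall X, exists x, f x = X.
    by move=> X; have [x _ <-] := @surj _ _ _ _ f X I; exists x.
  by exists j => X Y XY; rewrite -(fj X) -(fj Y) XY.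
rewrite card_eq_le; apply/andP; split.
  by apply/pcard_injP; exists t => x y _ _; apply: t_inj.
rewrite -(card_le_eql (inj_card_eq (in2W j_inj))); exact: subset_card_le.
Qed.

(* [nat -> bool] has cardinality 2 ^ aleph_0 *)
Theorem theorem7 :
  exists psi : sentence,
    forall G : graph, models G psi <-> [set: G] #= [set: nat -> bool].
Proof.
pose onto_rest := surjects_form (↑↑ord0 : 'I_4) (↑ord0) (↑↑↑ord0) ord0.
exists (framed_form (Not Bot) ⩓ Not (framed_form (Not onto_rest))) => G.
have leP : models G (framed_form (Not Bot)) <-> framed G (fun _ _ _ _ _ => True).
  by apply: models_framed => H a /=; split=> // _ [].
have ltP : models G (framed_form (Not onto_rest)) <->
    framed G (fun H n o d k => ~ @surjects H n o d k).
  apply: models_framed => H a.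
  have := sat_surjects (↑↑ord0) (↑ord0) (↑↑↑ord0) ord0 a.
  by rewrite /onto_rest /= => ->.
rewrite card_eq_continuum; split.
  move=> [/leP /framed_inj [t t_inj] nlt]; split; first by exists t.
  (* The leading [true] frees all reals starting with [false] for [Rest]. *)
  have e_inj : injective (scons true \o t) by apply: inj_comp t_inj; apply: scons_inj.
  apply: contrapT => nj; apply: nlt; apply/ltP; apply: (framed_code e_inj).
  move=> sur; apply: nj; apply: (code_surjects (R := scons false)) sur.
    exact: scons_inj.
  by move=> X v /(congr1 (@^~ 0%N)).
move=> [[t t_inj] [j j_inj]]; split; first by apply/leP; apply: (framed_code t_inj).
by move=> /ltP; apply: framed_surjects j_inj.
Qed.
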